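(* Let $\{X_i: i\in I\}$ be a family of Banach spaces and $\kappa$ a cardinal. Then (1) $\big(\bigoplus_{i\in I}X_i\big)_{\ell_1}$ has the $\kappa$-Daugavet property if and only if $X_i$ has the $\kappa$-Daugavet property for every $i\in I$. (2) $\big(\bigoplus_{i\in I}X_i\big)_{\ell_1}$ has the $\kappa$-perfect Daugavet property if and only if $X_i$ has the $\kappa$-perfect Daugavet property for every $i\in I$. In other words, $\mathfrak{Dau}\big(\big(\bigoplus_{i\in I}X_i\big)_{\ell_1}\big)=\min_{i\in I}\mathfrak{Dau}(X_i)$ and $\mathfrak{pDau}\big(\big(\bigoplus_{i\in I}X_i\big)_{\ell_1}\big)=\min_{i\in I}\mathfrak{pDau}(X_i)$.
   Context: All Banach spaces are real; $\big(\bigoplus_{i\in I}X_i\big)_{\ell_1}$ denotes the $\ell_1$-sum. $B_X$ and $S_X$ denote the closed unit ball and unit sphere of a Banach space $X$. A slice of $B_X$ is a nonempty intersection of $B_X$ with an open half-space, i.e. a set $\{x\in B_X: f(x)>\sup f(B_X)-\alpha\}$ with $f\in X^*$, $\alpha>0$. For a cardinal $\kappa$ (finite or infinite), $\{y_\alpha:\alpha<\kappa\}$ denotes a set of cardinality at most $\kappa$. $X$ has the $\kappa$-Daugavet property if for every family $\{y_\alpha:\alpha<\kappa\}\subseteq S_X$, every slice $S$ of $B_X$ and every $\varepsilon>0$ there is $x\in S$ with $\|y_\alpha+x\|>2-\varepsilon$ for all $\alpha<\kappa$. $X$ has the $\kappa$-perfect Daugavet property if for every family $\{y_\alpha:\alpha<\kappa\}\subseteq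 S_X$ and every slice $S$ of $B_X$ there is $x\in S$ with $\|y_\alpha+x\|=2$ for all $\alpha<\kappa$. For nonzero $X$, $\mathfrak{Dau}(X)$ (resp. $\mathfrak{pDau}(X)$) is the least cardinal $\kappa$ such that $X$ fails the $\kappa$-Daugavet (resp. $\kappa$-perfect Daugavet) property. *)

(* Defs.v *)
From HB Require Import structures.
From mathcomp Require Import all_boot all_order all_algebra finmap.
From mathcomp Require Import all_classical all_reals all_analysis.

Set Implicit Arguments.
Unset Strict Implicit.
Unset Printing Implicit Defensive.

Import Order.TTheory GRing.Theory Num.Theory.
Import numFieldNormedType.Exports.

Local Open Scope classical_set_scope.
Local Open Scope card_scope.
Local Open Scope ring_scope.

Section l1sum.
Context {R : realType} {I : choiceType} (X : I -> completeNormedModType R).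

Definition l1norm (x : forall i, X i) : \bar R :=
  (\esum_(i in [set: I]) (`|x i|)%:E)%E.

Record l1sum := L1Sum {
  l1val :> forall i, X i;
  l1valP : (l1norm l1val < +oo)%E }.

Lemma l1sum_ext (x y : l1sum) : (forall i, x i = y i) -> x = y.
Proof.
case: x y => [x px] [y py] /= xy.
have e : x = y by apply: functional_extensionality_dep.
by subst y; rewrite (Prop_irrelevance px py).
Qed.

HB.instance Definition _ := gen_eqMixin l1sum.
HB.instance Definition _ := gen_choiceMixin l1sum.

Lemma l1norm_ge0 (x : forall i, X i) : (0 <= l1norm x)%E.
Proof. by apply: esum_ge0 => i _; rewrite lee_fin. Qed.

Lemma l1normD (x y : forall i, X i) :
  (l1norm (fun i => x i + y i)%R <= l1norm x + l1norm y)%E.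
Proof.
rewrite /l1norm -esumD; try by move=> i _; rewrite lee_fin.
by apply: le_esum => i _; rewrite -EFinD lee_fin ler_normD.
Qed.

Lemma l1normZ_le (a : R) (x : forall i, X i) :
  (l1norm (fun i => a *: x i) <= (`|a|)%:E * l1norm x)%E.
Proof.
apply: ge_ereal_sup => _ [/= A [finA _] <-].
under eq_fsbigr do rewrite normrZ EFinM.
rewrite -ge0_mule_fsumr; last by move=> i; rewrite lee_fin.
rewrite lee_wpmul2l ?lee_fin//.
by apply: ereal_sup_ubound; exists A.
Qed.

Lemma l1norm0 : l1norm (fun i => 0 : X i) = 0%E.
Proof. by apply: esum1 => i _; rewrite normr0. Qed.

Lemma l1norm_lt0P : (l1norm (fun i => 0%R : X i) < +oo)%E.
Proof. by rewrite l1norm0 ltry. Qed.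

Lemma l1norm_ltDP (x y : l1sum) : (l1norm (fun i => x i + y i)%R < +oo)%E.
Proof.
by apply: le_lt_trans (l1normD x y) _; rewrite lte_add_pinfty ?l1valP.
Qed.

Lemma l1norm_ltZP (a : R) (x : l1sum) : (l1norm (fun i => a *: x i)%R < +oo)%E.
Proof.
apply: le_lt_trans (l1normZ_le a x) _.
by rewrite lte_mul_pinfty ?lee_fin ?l1valP.
Qed.

Lemma l1norm_ltNP (x : l1sum) : (l1norm (fun i => - x i)%R < +oo)%E.
Proof.
have -> : (fun i => - x i) = (fun i => (- 1) *: x i).
  by apply: functional_extensionality_dep => i; rewrite scaleN1r.
exact: l1norm_ltZP.
Qed.

Definition l1zero : l1sum := L1Sum l1norm_lt0P.
Definition l1add (x y : l1sum) : l1sum := L1Sum (l1norm_ltDP x y).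
Definition l1opp (x : l1sum) : l1sum := L1Sum (l1norm_ltNP x).
Definition l1scale (a : R) (x : l1sum) : l1sum := L1Sum (l1norm_ltZP a x).

Lemma l1addA : associative l1add.
Proof. by move=> x y z; apply: l1sum_ext => i /=; rewrite addrA. Qed.
Lemma l1addC : commutative l1add.
Proof. by move=> x y; apply: l1sum_ext => i /=; rewrite addrC. Qed.
Lemma l1add0 : left_id l1zero l1add.
Proof. by move=> x; apply: l1sum_ext => i /=; rewrite add0r. Qed.
Lemma l1addN : left_inverse l1zero l1opp l1add.
Proof. by move=> x; apply: l1sum_ext => i /=; rewrite addNr. Qed.

HB.instance Definition _ :=
  GRing.isZmodule.Build l1sum l1addA l1addC l1add0 l1addN.

Lemma l1scaleA (a b : R) (x : l1sum) :
  l1scale a (l1scale b x) = l1scale (a * b) x.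
Proof. by apply: l1sum_ext => i /=; rewrite scalerA. Qed.
Lemma l1scale1 : left_id 1 l1scale.
Proof. by move=> x; apply: l1sum_ext => i /=; rewrite scale1r. Qed.
Lemma l1scaleDr : right_distributive l1scale +%R.
Proof. by move=> a x y; apply: l1sum_ext => i /=; rewrite scalerDr. Qed.
Lemma l1scaleDl (x : l1sum) : {morph l1scale^~ x : a b / a + b}.
Proof. by move=> a b; apply: l1sum_ext => i /=; rewrite scalerDl. Qed.

HB.instance Definition _ := GRing.Zmodule_isLmodule.Build R l1sum
  l1scaleA l1scale1 l1scaleDr l1scaleDl.

Definition l1sum_norm (x : l1sum) : R := fine (l1norm x).

Lemma l1sum_normE (x : l1sum) : (l1sum_norm x)%:E = l1norm x.
Proof. by rewrite fineK// ge0_fin_numE ?l1norm_ge0 ?l1valP. Qed.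

Lemma l1sum_normD (x y : l1sum) :
  l1sum_norm (x + y) <= l1sum_norm x + l1sum_norm y.
Proof. by rewrite -lee_fin EFinD !l1sum_normE l1normD. Qed.

Lemma l1sum_normZ (a : R) (x : l1sum) :
  l1sum_norm (a *: x) = `|a| * l1sum_norm x.
Proof.
have le b y : l1sum_norm (b *: y) <= `|b| * l1sum_norm y.
  by rewrite -lee_fin EFinM !l1sum_normE l1normZ_le.
apply/eqP; rewrite eq_le le/=.
have [->|a0] := eqVneq a 0.
  by rewrite normr0 mul0r fine_ge0 ?l1norm_ge0.
have := le a^-1 (a *: x); rewrite scalerA mulVf// scale1r normfV.
by rewrite mulrC ler_pdivlMr ?normr_gt0// mulrC.
Qed.

Lemma l1sum_le_norm (x : l1sum) i : `|x i| <= l1sum_norm x.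
Proof.
rewrite -lee_fin l1sum_normE; apply: esum_ge; exists [set i] => //.
by rewrite fsbig_set1.
Qed.

Lemma l1sum_norm0_eq0 (x : l1sum) : l1sum_norm x = 0 -> x = 0.
Proof.
move=> x0; apply: l1sum_ext => i /=; apply/eqP.
by rewrite -normr_le0 -x0 l1sum_le_norm.
Qed.

HB.instance Definition _ := Lmodule_isNormed.Build R l1sum
  l1sum_normD l1sum_normZ l1sum_norm0_eq0.

Lemma l1sumE (x : l1sum) : (`|x|)%:E = l1norm x.
Proof. exact: l1sum_normE. Qed.

Lemma l1norm_cauchy_bound (F : set_system l1sum) (l : forall i, X i) (e : R)
    (y : l1sum) :
  ProperFilter F -> (forall i, (fun x : l1sum => x i) @ F --> l i) ->
  (\forall z \near F, `|y - z| < e) -> (l1norm (fun i => y i - l i)%R <= e%:E)%E.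
Proof.
move=> FF Fl yF; apply: ge_ereal_sup => _ [/= A [finA _] <-].
rewrite fsbig_finite//= sumEFin lee_fin.
have cv : (fun z : l1sum => \sum_(i <- fset_set A) `|y i - z i|) @ F -->
    \sum_(i <- fset_set A) `|y i - l i|.
  apply: cvg_big => [|i _]; first exact: add_continuous.
  apply: cvg_norm.
  by apply: cvgB; [exact: cvg_cst|exact: Fl].
apply: (cvgr_to_le cv).
apply: filterS yF => z /ltW; apply: le_trans.
rewrite -lee_fin l1sumE -sumEFin -fsbig_finite//.
by apply: ereal_sup_ubound; exists A.
Qed.

Lemma l1sum_complete (F : set_system l1sum) :
  ProperFilter F -> cauchy F -> cvg F.
Proof.
move=> FF /cauchy_ballP cF.
have ex i : cvg ((fun x : l1sum => x i) @ F).
  apply: cauchy_cvg; apply/cauchy_ballP => e e0.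
  have [[P Q] /= [FP FQ] PQ] := cF e e0.
  exists ((fun x : l1sum => x i) @` P, (fun x : l1sum => x i) @` Q) => /=.
    split.
      by apply: filterS FP => x Px /=; exists x.
    by apply: filterS FQ => x Qx /=; exists x.
  move=> [_ _] /= [[x Px <-] [y Qy <-]].
  have := PQ (x, y) (conj Px Qy); rewrite -!ball_normE /=.
  apply: le_lt_trans; exact: (l1sum_le_norm (x - y) i).
pose l i := lim ((fun x : l1sum => x i) @ F).
have near_l (e : R) : 0 < e -> \forall y \near F,
    (l1norm (fun i => (y : l1sum) i - l i)%R <= e%:E)%E.
  move=> e0; have [[P Q] /= [FP FQ] PQ] := cF e e0.
  apply: filterS FP => y Py; apply: (l1norm_cauchy_bound (F := F)) => //.
  apply: filterS FQ => z Qz.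
  by have := PQ (y, z) (conj Py Qz); rewrite -!ball_normE.
have lfin : (l1norm l < +oo)%E.
  have [y ly] := filter_ex (near_l 1 ltr01).
  have lt1 : (l1norm (fun i => y i - l i)%R < +oo)%E.
    by apply: le_lt_trans ly _; rewrite ltry.
  have -> : l = l1val (y - L1Sum lt1).
    by apply: functional_extensionality_dep => i /=; rewrite subKr.
  exact: l1valP.
apply/cvg_ex; exists (L1Sum lfin); apply/(@cvgrPdist_le _ _ _ F _ id) => e e0.
apply: filterS (near_l e e0) => y ly; rewrite distrC -lee_fin l1sumE.
exact: ly.
Qed.

HB.instance Definition _ := Uniform_isComplete.Build l1sum l1sum_complete.

End l1sum.

Section Daugavet.
Context {R : realType}.
Implicit Type X : normedModType R.

Definition unit_ball X : set X := [set x | `|x| <= 1].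
Definition unit_sphere X : set X := [set x | `|x| = 1].

Definition is_slice X (S : set X) : Prop :=
  exists (f : {linear X -> R^o}) (a : R), [/\ continuous f, 0 < a &
    S = [set x | unit_ball x /\ sup (f @` @unit_ball X) - a < f x]].

(* A cardinal is represented by a type [K], up to equinumerosity; a family
   [{y_alpha : alpha < K}] is a set [Y] of cardinality at most [K]. *)
Definition Daugavet (K : Type) X : Prop :=
  forall Y : set X, Y `<=` @unit_sphere X -> Y #<= [set: K] ->
  forall S, is_slice S -> forall e : R, 0 < e ->
  exists2 x, S x & forall y, Y y -> 2 - e < `|y + x|.

Definition perfect_Daugavet (K : Type) X : Prop :=
  forall Y : set X, Y `<=` @unit_sphere X -> Y #<= [set: K] ->
  forall S, is_slice S -> exists2 x, S x & forall y, Y y -> `|y + x| = 2.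

Definition nonzero X : Prop := exists x : X, x != 0.

End Daugavet.

Definition least_cardinal (P : Type -> Prop) (K : Type) : Prop :=
  P K /\ forall L : Type, P L -> [set: K] #<= [set: L].

(* [is_Dau X K] reads "Dau(X) exists and equals |K|". *)
Definition is_Dau {R : realType} (X : normedModType R) : Type -> Prop :=
  least_cardinal (fun K => ~ Daugavet K X).

Definition is_pDau {R : realType} (X : normedModType R) : Type -> Prop :=
  least_cardinal (fun K => ~ perfect_Daugavet K X).

(* For a relation [c i K] reading "the i-th cardinal exists and equals |K|":
   all the cardinals indexed by [A] exist, and their minimum is |K|. *)
Definition is_min_cardinal (I : Type) (A : set I) (c : I -> Type -> Prop)
    (K : Type) : Prop :=
  (exists2 i, A i & c i K) /\
  (forall i, A i -> exists2 L : Type, c i L & [set: K] #<= [set: L]).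

(* Main.v *)
(* From the summands to the sum: a slice of the ball of the sum contains the
   image of a slice of the ball of some summand X i, because the norm of a
   functional is the supremum of the norms of its restrictions.  Replacing each
   y by the normalization of y i gives a family in the sphere of X i, and
   |y i / |y i| + u| <= |y + u| for u in X i.  From the sum to X i: if x lies
   in a small slice defined by a nonzero functional on X i, then |x i| > 1/2
   and, u being a unit vector of X i,
   |x i| * (2 - |u + x i / |x i||) <= 2 - |u + x|.  A slice given by the zero
   functional is the whole ball; it is shrunk by means of Hahn-Banach. *)
From HB Require Import structures.
Require Import Defs.
From mathcomp Require Import all_boot all_order all_algebra.
From mathcomp Require Import all_classical all_reals all_analysis.
From mathcomp Require Import lra.

Set Implicit Arguments.
Unset Strict Implicit.
Unset Printing Implicit Defensive.

Import Order.TTheory GRing.Theory Num.Theory.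
Import numFieldNormedType.Exports.

Local Open Scope classical_set_scope.
Local Open Scope card_scope.
Local Open Scope ring_scope.

(** * Least cardinals, by comparing types through injections *)

(* Hönig's argument: a maximal set of choice functions on which every
   evaluation is injective must have a surjective evaluation. *)
Lemma least_type_of_family (J : Type) (A : J -> Type) :
  J -> exists i, forall j, [set: A i] #<= [set: A j].
Proof.
move=> j0.
pose P (C : set (forall j, A j)) :=
  forall j h h', C h -> C h' -> h j = h' j -> h = h'.
have [F FP totF|C [injC maxC]] := @Zorn_bigcup _ P.
  move=> j h h' [C FC Ch] [C' FC' Ch'] hh'.
  have [CC'|C'C] := totF _ _ FC FC'.
    by apply: (FP _ FC' j) => //; exact: CC'.
  by apply: (FP _ FC j) => //; exact: C'C.
have [i surji] : exists i, forall a : A i, exists h, C h /\ h i = a.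
  (* Otherwise the missed values, one per index, form a function that could be added to [C]. *)
  apply: contrapT => /forallNP nsurj.
  have fresh j : exists a : A j, forall h, C h -> h j <> a.
    have /existsNP[a /forallNP na] := nsurj j.
    by exists a => h Ch ha; apply: (na h).
  pose h0 j := sval (cid (fresh j)).
  have h0C j h : C h -> h j <> h0 j by exact: (svalP (cid (fresh j))).
  apply: (maxC (C `|` [set h0])).
    split; first by move=> h Ch; left.
    by move=> /(_ h0 (or_intror erefl)) Ch0; exact: (h0C j0 _ Ch0).
  move=> j h h' [Ch|->] [Ch'|->] //.
  - exact: injC.
  - by move=> /h0C; move/(_ Ch).
  - by move=> /esym/h0C; move/(_ Ch').
exists i => j; pose f a := sval (cid (surji a)) j.
have [g] : $|{injfun [set: A i] >-> [set: A j]}|; last exact: inj_card_le.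
apply/injfunPex; exists f => // a b _ _; rewrite /f.
case: cid => h [Ch ha]; case: cid => h' [Ch' hb] /= hh'.
by rewrite -ha -hb (injC _ _ _ Ch Ch' hh').
Qed.

(** The two types form a family indexed by [bool], whose least member injects into the other. *)
Lemma card_le_total (T U : Type) :
  [set: T] #<= [set: U] \/ [set: U] #<= [set: T].
Proof.
have [b leb] := least_type_of_family (fun b : bool => if b then T else U) true.
by case: b leb => leb; [left; exact: (leb false)|right; exact: (leb true)].
Qed.

Definition card_upward_closed (P : Type -> Prop) :=
  forall K L : Type, [set: K] #<= [set: L] -> P K -> P L.

(* Minimizing over the subsets of one type satisfying P, rather than over all
   such types, avoids a universe inconsistency. *)
Lemma least_cardinal_exists (P : Type -> Prop) : card_upward_closed P ->
  (exists K, P K) -> exists K, least_cardinal P K.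
Proof.
move=> upP [K0 PK0].
have PT : P [set: K0] by apply: upP PK0; have /card_eqPle[] := card_setT [set: K0].
have [[B PB] leB] := least_type_of_family
  (fun B : {B : set K0 | P B} => sval B : Type) (exist _ [set: K0] PT).
exists B; split=> // L PL.
have BK0 : [set: B] #<= [set: K0].
  by have /card_eqPle[/card_le_trans-> //] := card_setT B; exact: card_leT.
(* When [L] embeds in [K0], minimality of [B] applies to a copy of [L] inside [K0]; otherwise [B]
   embeds in [L] through [K0]. *)
have [/card_subP[C CL _]|/(card_le_trans BK0)//] := card_le_total L K0.
have /card_eqPle[CleL LleC] := card_eq_trans (card_setT C) CL.
exact: card_le_trans (leB (exist _ C (upP _ _ LleC PL))) CleL.
Qed.

(** An index whose own least cardinal is smallest gives the least cardinal of the union. With [c i]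
    the failure of a Daugavet property, this turns an equivalence into an identity of minima. *)
Lemma least_cardinal_bigcup (J : Type) (A : set J) (c : J -> Type -> Prop) :
  A !=set0 -> (forall i, card_upward_closed (c i)) ->
  (forall i, A i -> exists K, c i K) ->
  exists K, least_cardinal (fun K => exists2 i, A i & c i K) K /\
    is_min_cardinal A (fun i => least_cardinal (c i)) K.
Proof.
move=> [j0 Aj0] upc ex.
have least i : A i -> exists K, least_cardinal (c i) K.
  by move=> Ai; apply: least_cardinal_exists => //; exact: ex.
pose k (i : {i | A i}) := sval (cid (least _ (svalP i))).
have kP i : least_cardinal (c (sval i)) (k i).
  exact: (svalP (cid (least _ (svalP i)))).
have [i lei] := least_type_of_family k (exist A j0 Aj0).
exists (k i); split; split.
- by exists (sval i); [exact: svalP | exact: (kP i).1].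
- move=> L [j Aj cL]; apply: card_le_trans (lei (exist A j Aj)) _.
  exact: (kP (exist A j Aj)).2.
- by exists (sval i); [exact: svalP | exact: kP].
- by move=> j Aj; exists (k (exist A j Aj)); [exact: (kP (exist A j Aj)) | exact: lei].
Qed.

(** * Hahn-Banach: a functional dominated by the norm that norms a given vector *)

Section norming_functional.
Context {R : realType} {X : normedModType R}.

(** Partial linear functionals as graphs, ready for Zorn's lemma under inclusion. They are
    single-valued: two values at one point differ by a value at 0, which is at most 0. *)
Record dominated_graph (G : set (X * R)) : Prop := DominatedGraph {
  graph_lin : forall a p q, G p -> G q -> G (a *: p.1 + q.1, a * p.2 + q.2);
  graph_le : forall p, G p -> p.2 <= `|p.1| }.

(** The value [c] at [x] must lie above every [p.2 - |p.1 - x|] and below every [|q.1 + x| - q.2];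
    the triangle inequality leaves room, and the supremum of the lower bounds serves. *)
Lemma dominated_graph_extend (G : set (X * R)) (x : X) :
  dominated_graph G -> G (0, 0) ->
  exists c, dominated_graph
    [set r | exists p t, G p /\ r = (p.1 + t *: x, p.2 + t * c)].
Proof.
move=> [linG leG] G0.
have GZ a p : G p -> G (a *: p.1, a * p.2).
  by move=> Gp; have := linG a _ _ Gp G0; rewrite !addr0.
pose E := [set p.2 - `|p.1 - x| | p in G].
have leE p q : G p -> G q -> p.2 - `|p.1 - x| <= `|q.1 + x| - q.2.
  move=> Gp Gq; have /leG/= := linG 1 _ _ Gp Gq; rewrite scale1r mul1r => h.
  have := ler_normD (p.1 - x) (q.1 + x).
  by rewrite addrACA addNr addr0; lra.
have E0 : E !=set0 by exists (0 - `|0 - x|), (0, 0).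
have Eub : has_ubound E.
  by exists (`|0 + x| - 0) => _ [p Gp <-]; exact: (leE p (0, 0)).
exists (sup E); split=> [a _ _ [p [t [Gp ->]]] [q [s [Gq ->]]]|_ [p [t [Gp ->]]]] /=.
  exists (a *: p.1 + q.1, a * p.2 + q.2), (a * t + s); split; first exact: linG.
  congr (_, _) => /=.
    by rewrite scalerDr scalerDl addrACA scalerA.
  by lra.
(* Dividing by [-t] or by [t] reduces domination to the lower or the upper bound on [c]. *)
have [t0|t0|->] := ltgtP t 0; last by rewrite scale0r mul0r !addr0 leG.
- have h : t^-1 != 0 by rewrite invr_eq0 lt_eqF.
  have u : (- t^-1) * p.2 - `|(- t^-1) *: p.1 - x| <= sup E.
    by apply: ub_le_sup => //; exists (- t^-1 *: p.1, - t^-1 * p.2) => //; exact: GZ.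
  have e : `|(- t^-1) *: p.1 - x| = (- t)^-1 * `|p.1 + t *: x|.
    rewrite -[X in X * _]gtr0_norm ?invr_gt0 ?oppr_gt0// -normrZ scalerDr scalerA.
    by rewrite invrN mulNr mulVf ?lt_eqF// scaleN1r.
  rewrite e invrN in u.
  have : - t * (- t^-1 * p.2 - - t^-1 * `|p.1 + t *: x|) <= - t * sup E.
    by rewrite ler_pM2l ?oppr_gt0.
  rewrite mulrBr !mulrA !mulrNN divff ?lt_eqF// !mul1r; lra.
- have u : sup E <= `|t^-1 *: p.1 + x| - t^-1 * p.2.
    apply: ge_sup => // _ [q Gq <-].
    by apply: (leE q (t^-1 *: p.1, t^-1 * p.2)) => //; exact: GZ.
  have e : `|t^-1 *: p.1 + x| = t^-1 * `|p.1 + t *: x|.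
    rewrite -[X in X * _]gtr0_norm ?invr_gt0// -normrZ scalerDr scalerA.
    by rewrite mulVf ?gt_eqF// scale1r.
  rewrite e in u.
  have : t * sup E <= t * (t^-1 * `|p.1 + t *: x| - t^-1 * p.2).
    by rewrite ler_pM2l.
  rewrite mulrBr !mulrA divff ?gt_eqF// !mul1r; lra.
Qed.

Lemma total_dominated_graph (x0 : X) : exists G, [/\ dominated_graph G,
  G (x0, `|x0|) & forall x, exists r, G (x, r)].
Proof.
(* The second clause is guarded by membership because the empty chain has the empty set as its
   union. *)
pose P G := dominated_graph G /\ forall p, G p -> G (x0, `|x0|).
have [F FP totF|G [[domG G0] maxG]] := @Zorn_bigcup _ P.
  split; last by move=> p [C FC Cp]; exists C => //; exact: (FP _ FC).2 _ Cp.
  split=> [a p q [C FC Cp] [C' FC' Cq]|p [C FC Cp]]; last first.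
    exact: graph_le (FP _ FC).1 _ Cp.
  have [CC'|C'C] := totF _ _ FC FC'.
    by exists C' => //; apply: (graph_lin (FP _ FC').1) => //; exact: CC'.
  by exists C => //; apply: (graph_lin (FP _ FC).1) => //; exact: C'C.
have Gx0 : G (x0, `|x0|).
  (* A maximal graph is not empty, since the line through [(x0, |x0|)] would properly contain it. *)
  apply: contrapT => nG; have Gempty p : ~ G p by move=> /G0.
  apply: (maxG [set p | exists t, p = (t *: x0, t * `|x0|)]).
    split; first by move=> p /Gempty.
    move=> /(_ (x0, `|x0|)) /(_ _)/Gempty; apply.
    by exists 1; rewrite scale1r mul1r.
  split; last by exists 1; rewrite scale1r mul1r.
  split=> [a _ _ [t ->] [s ->]|_ [t ->]] /=.
    by exists (a * t + s); rewrite scalerDl scalerA mulrDl mulrA.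
  by rewrite normrZ ler_wpM2r// ler_norm.
exists G; split=> // x; apply: contrapT => /forallNP nGx.
have G00 : G (0, 0).
  have := graph_lin domG (-1) Gx0 Gx0.
  by rewrite /= scaleN1r mulN1r !addNr.
have [c domG'] := dominated_graph_extend x domG G00.
have sub p : G p -> exists q t, G q /\ p = (q.1 + t *: x, q.2 + t * c).
  by case: p => u r Gp; exists (u, r), 0; rewrite scale0r mul0r !addr0.
apply: (maxG _ _ (conj domG' (fun _ _ => sub _ Gx0))); split; first exact: sub.
move=> /(_ (x, c)) h; apply: (nGx c); apply: h.
by exists (0, 0), 1; rewrite scale1r mul1r !add0r.
Qed.

(** Domination at [x] and at [-x] bounds the total functional by the norm, hence its continuity. *)
Lemma norming_functional (x0 : X) : exists f : {linear X -> R^o},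
  continuous f /\ f x0 = `|x0|.
Proof.
have [G [domG Gx0 totG]] := total_dominated_graph x0.
have funG x r s : G (x, r) -> G (x, s) -> r <= s.
  move=> Gr Gs; have /= := graph_le domG (graph_lin domG (-1) Gs Gr).
  by rewrite scaleN1r addNr normr0 mulN1r addrC subr_le0.
pose f x : R^o := sval (cid (totG x)).
have Gf x : G (x, f x) by exact: (svalP (cid (totG x))).
have GfE x r : G (x, r) -> f x = r.
  by move=> Gr; apply/le_anti; rewrite (funG _ _ _ (Gf x) Gr) (funG _ _ _ Gr (Gf x)).
have linf : linear f by move=> a x y; apply: GfE; exact: (graph_lin domG a (Gf x) (Gf y)).
pose fL : {linear X -> R^o} := HB.pack f (GRing.isLinear.Build _ _ _ _ f linf).
exists fL; split; last exact: GfE.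
apply: bounded_linear_continuous; exists 1; split=> // M M1.
near=> x.
have le1 : `|x| <= 1.
  near: x; apply/nbhs_ballP; exists 1 => //= y.
  by rewrite -ball_normE/= sub0r normrN => /ltW.
apply: le_trans (ltW M1); apply: le_trans le1.
rewrite ler_norml (graph_le domG (Gf x)) andbT lerNl.
by rewrite -linearN -normrN; exact: (graph_le domG (Gf (- x))).
Unshelve. all: by end_near. Qed.

End norming_functional.

(** * Norms of functionals and slices *)

Section functional_sup.
Context {R : realType} {X : normedModType R}.

(** The dual norm of [f] when [f] is linear and continuous. *)
Definition ball_sup (f : X -> R^o) : R := sup (f @` @unit_ball R X).

Section continuous_functional.
Variable f : {linear X -> R^o}.
Hypothesis cf : continuous f.

Lemma ball_image_has_sup : has_sup (f @` @unit_ball R X).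
Proof.
split; first by exists (f 0), 0 => //; rewrite /unit_ball /= normr0.
have [|M [_ fM]] := (linear_boundedP f).1; first exact/linear_bounded_continuous.
have Mb : `|M| < `|M| + 1 by rewrite ltrDl.
exists (`|M| + 1) => _ [x /= x1 <-].
apply: le_trans (ler_norm _) _.
apply: le_trans (fM (`|M| + 1) (le_lt_trans (ler_norm _) Mb) x) _.
by rewrite ler_piMr// addr_ge0.
Qed.

Lemma le_ball_sup x : `|x| <= 1 -> f x <= ball_sup f.
Proof.
by move=> x1; apply: ub_le_sup; [exact: ball_image_has_sup.2|exists x].
Qed.

Lemma ball_sup_ge0 : 0 <= ball_sup f.
Proof. by rewrite -(linear0 f) le_ball_sup// normr0. Qed.

Lemma le_ball_sup_norm x : f x <= ball_sup f * `|x|.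
Proof.
have [->|x0] := eqVneq x 0; first by rewrite linear0 normr0 mulr0.
have nx : 0 < `|x| by rewrite normr_gt0.
rewrite -ler_pdivrMr// mulrC.
rewrite -[X in X <= _]/(`|x|^-1 *: f x : R^o) -linearZ le_ball_sup//.
by rewrite normrZ normfV normr_id mulVf// gt_eqF.
Qed.

End continuous_functional.

Definition slice (f : X -> R^o) (a : R) : set X :=
  [set x | unit_ball x /\ ball_sup f - a < f x].

Lemma slice_is_slice (f : {linear X -> R^o}) (a : R) :
  continuous f -> 0 < a -> is_slice (slice f a).
Proof. by move=> cf a0; exists f, a; split. Qed.

Lemma slice_nonempty (S : set X) : is_slice S -> S !=set0.
Proof.
move=> [f [a [cf a0 ->]]].
have [_ [x x1 <-] fx] := sup_adherent a0 (ball_image_has_sup cf).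
by exists x.
Qed.

(** A positive norm allows slice widths proportional to it. If the norm is zero, the slice is the
    whole ball and contains every slice of a norming functional. *)
Lemma ball_sup_gt0_slice (S : set X) : nonzero X -> is_slice S ->
  exists (f : {linear X -> R^o}) (a : R),
    [/\ continuous f, 0 < a, 0 < ball_sup f & slice f a `<=` S].
Proof.
move=> [x0 x0n] [f [a [cf a0 ->]]].
have [f0|f0] := ltP 0 (ball_sup f); first by exists f, a; split.
have [g [cg gx0]] := norming_functional x0.
exists g, 1; split=> //.
  have := le_ball_sup_norm cg x0; rewrite gx0 => h.
  have nx : 0 < `|x0| by rewrite normr_gt0.
  by apply: lt_le_trans ltr01 _; rewrite -(ler_pM2r nx) mul1r.
move=> x [x1 _]; split=> //.
have : - ball_sup f <= f x.
  rewrite lerNl -[X in X <= _](linearN f) le_ball_sup//.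
  by rewrite normrN.
have := ball_sup_ge0 cf; rewrite -/(ball_sup f); lra.
Qed.

End functional_sup.

(** * Monotonicity in the cardinal; zero and nonzero spaces *)

Lemma not_Daugavet_upward (R : realType) (X : normedModType R) :
  card_upward_closed (fun K => ~ Daugavet K X).
Proof.
move=> K L KL nD D; apply: nD => Y Ysph YK.
by apply: D => //; exact: card_le_trans YK KL.
Qed.

Lemma not_perfect_Daugavet_upward (R : realType) (X : normedModType R) :
  card_upward_closed (fun K => ~ perfect_Daugavet K X).
Proof.
move=> K L KL nD D; apply: nD => Y Ysph YK.
by apply: D => //; exact: card_le_trans YK KL.
Qed.

Lemma perfect_Daugavet_Daugavet (R : realType) (X : normedModType R) (K : Type) :
  perfect_Daugavet K X -> Daugavet K X.
Proof.
move=> pD Y Ysph YK S sS e e0; have [x Sx xY] := pD Y Ysph YK S sS.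
by exists x => // y Yy; rewrite xY// ltrBlDr ltrDl.
Qed.

(** The unit sphere is empty, so any point of the slice will do. *)
Lemma zero_perfect_Daugavet (R : realType) (X : normedModType R) (K : Type) :
  ~ nonzero X -> perfect_Daugavet K X.
Proof.
move=> X0 Y Ysph _ S /slice_nonempty[x Sx]; exists x => // y /Ysph y1.
exfalso; apply: X0; exists y.
by rewrite -normr_gt0 y1.
Qed.

(* The unit sphere itself is a failing family: x is within 1 of -x/|x|. *)
Lemma nonzero_not_Daugavet (R : realType) (X : normedModType R) :
  nonzero X -> ~ Daugavet X X.
Proof.
move=> [x0 x0n] D.
have nx : `|x0| != 0 by rewrite normr_eq0.
have unit (x : X) : x != 0 -> unit_sphere (`|x|^-1 *: x).
  by move=> x0'; rewrite /unit_sphere /= normrZ normfV normr_id mulVf ?normr_eq0.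
(* The zero functional makes the whole ball a slice. *)
have sl : is_slice (@slice R X (\0 : {linear X -> R^o}) 1).
  by apply: slice_is_slice => //; exact: cst_continuous.
have [x [x1 _] far] :=
  D _ (@subset_refl _ (@unit_sphere R X)) (card_leT _) _ sl 1 ltr01.
(* At [x = 0] the sums have norm 1, which does not exceed [2 - 1]. *)
have x0' : x != 0.
  apply/eqP => xE; have := far _ (unit _ x0n).
  by rewrite xE addr0 (unit _ x0n); lra.
have := far (- (`|x|^-1 *: x)).
rewrite /unit_sphere /= normrN => /(_ (unit _ x0')).
have -> : - (`|x|^-1 *: x) + x = (1 - `|x|^-1) *: x.
  by rewrite scalerBl scale1r addrC.
rewrite normrZ.
have nx' : 0 < `|x| by rewrite normr_gt0.
rewrite -{2}[`|x|]gtr0_norm// -normrM mulrBl mulVf ?gt_eqF// mul1r.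
rewrite distrC ger0_norm ?subr_ge0//; lra.
Qed.

(** * Coordinate projections and embeddings of the sum *)

Section l1sum_coordinates.
Context {R : realType} {I : choiceType} (X : I -> completeNormedModType R).

Definition coord i (x : l1sum X) : X i := x i.

Arguments coord : simpl never.

Lemma l1sum_norm_split (x : l1sum X) i :
  (`|x|)%:E = ((`|coord i x|)%:E + \esum_(j in ~` [set i]) (`|coord j x|)%:E)%E.
Proof.
rewrite l1sumE /l1norm (esumID [set i]); last by move=> j _; rewrite lee_fin.
by rewrite !setTI esum_set1// lee_fin.
Qed.

(** The other coordinates contribute the same amount to both norms, and this amount is finite. *)
Lemma l1sum_norm_off (x y : l1sum X) i :
  (forall j, j != i -> coord j x = coord j y) ->
  `|x| - `|coord i x| = `|y| - `|coord i y|.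
Proof.
move=> xy; have := l1sum_norm_split x i; have := l1sum_norm_split y i.
rewrite (@eq_esum _ _ (~` [set i]) (fun j => (`|coord j x|)%:E)
  (fun j => (`|coord j y|)%:E)).
  case: (\esum_(j in _) _)%E => [r| |] //.
  by rewrite -!EFinD => -[->] [->]; lra.
by move=> j /eqP/xy ->.
Qed.

(** Since the type of a value depends on [j], [u] is transported along the equality of indices. *)
Definition coord_inj_fun i (u : X i) (j : I) : X j :=
  if i =P j is ReflectT e then ecast k (X k) e u else 0.

Lemma coord_inj_funE i (u : X i) : coord_inj_fun u i = u.
Proof. by rewrite /coord_inj_fun; case: eqP => // e; rewrite eq_axiomK. Qed.

Lemma coord_inj_fun_off i (u : X i) j : j != i -> coord_inj_fun u j = 0.
Proof. by rewrite /coord_inj_fun; case: eqP => // e /eqP[]; exact: esym. Qed.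

Lemma coord_inj_subproof i (u : X i) : (l1norm (coord_inj_fun u) < +oo)%E.
Proof.
rewrite /l1norm (esumID [set i]); last by move=> j _; rewrite lee_fin.
rewrite !setTI esum_set1 ?lee_fin// esum1 ?adde0 ?ltry// => j /eqP ji.
by rewrite coord_inj_fun_off// normr0.
Qed.

Definition coord_inj i (u : X i) : l1sum X := L1Sum (coord_inj_subproof u).

Lemma coord_injE i (u : X i) : coord i (coord_inj u) = u.
Proof. exact: coord_inj_funE. Qed.

Lemma coord_is_linear i : linear (@coord i).
Proof. by []. Qed.

HB.instance Definition _ i :=
  GRing.isLinear.Build R (l1sum X) (X i) _ (@coord i) (@coord_is_linear i).

Lemma coord_inj_is_linear i : linear (@coord_inj i).
Proof.
move=> a u v; apply: l1sum_ext => j /=.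
have [->|ji] := eqVneq j i; first by rewrite !coord_inj_funE.
by rewrite !coord_inj_fun_off// scaler0 addr0.
Qed.

HB.instance Definition _ i :=
  GRing.isLinear.Build R (X i) (l1sum X) _ (@coord_inj i) (@coord_inj_is_linear i).

(** Only coordinate [i] changes, so the rest of the norm, [|y| - |coord i y|], is kept. *)
Lemma norm_add_coord_inj i (u : X i) (y : l1sum X) :
  `|y + coord_inj u| = `|coord i y + u| + (`|y| - `|coord i y|).
Proof.
have -> : coord i y + u = coord i (y + coord_inj u).
  by rewrite linearD /= coord_injE.
have off j : j != i -> coord j (y + coord_inj u) = coord j y.
  by move=> ji; rewrite /coord /= coord_inj_fun_off// addr0.
by rewrite -(l1sum_norm_off off) subrKC.
Qed.

Lemma norm_coord_inj i (u : X i) : `|coord_inj u| = `|u|.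
Proof.
have := norm_add_coord_inj u 0.
by rewrite add0r linear0 !normr0 subr0 add0r addr0.
Qed.

Lemma norm_coord_le i (x : l1sum X) : `|coord i x| <= `|x|.
Proof. exact: l1sum_le_norm. Qed.

Lemma contraction_continuous (V W : normedModType R) (f : {linear V -> W}) :
  (forall x, `|f x| <= `|x|) -> continuous f.
Proof.
move=> fle; apply/linear_bounded_continuous/linear_boundedP.
near=> r => x; apply: le_trans (fle x) _.
by rewrite ler_peMl//; near: r; apply: nbhs_pinfty_ge.
Unshelve. all: by end_near. Qed.

Lemma coord_continuous i : continuous (@coord i).
Proof. by apply: contraction_continuous => x; exact: norm_coord_le. Qed.

Lemma coord_inj_continuous i : continuous (@coord_inj i).
Proof. by apply: contraction_continuous => x; rewrite norm_coord_inj. Qed.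

Lemma nonzero_coord : nonzero (l1sum X) -> exists i, nonzero (X i).
Proof.
move=> [x x0]; apply: contrapT => /forallNP nz; move/negP: x0; apply.
apply/eqP/l1sum_ext => i; apply/eqP/contraT => xi0.
by case: (nz i); exists (x i).
Qed.

Lemma norm_sub_truncation (x : l1sum X) (s : seq I) : uniq s ->
  `|x - \sum_(i <- s) coord_inj (coord i x)| = `|x| - \sum_(i <- s) `|coord i x|.
Proof.
elim: s x => [|i s IHs] x /=; first by rewrite !big_nil !subr0.
move=> /andP[si us]; rewrite !big_cons.
(* Removing coordinate [i] first leaves the coordinates in [s] intact, as [i] is not in [s]. *)
pose x' := x - coord_inj (coord i x).
have x'j j : j != i -> coord j x' = coord j x.
  by move=> ji; rewrite /x' /coord /= coord_inj_fun_off// subr0.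
have x'x : `|x'| = `|x| - `|coord i x|.
  rewrite /x' -linearN norm_add_coord_inj subrr normr0 add0r.
  by [].
have e : forall j, j \in s -> coord j x' = coord j x.
  by move=> j js; apply: x'j; apply: contraNneq si => <-.
have := IHs x' us; rewrite x'x.
rewrite [in X in _ = X -> _](eq_big_seq (fun j => `|coord j x|)); last first.
  by move=> j js; rewrite e.
rewrite [in X in X = _ -> _](eq_big_seq (fun j => coord_inj (coord j x))); last first.
  by move=> j js; rewrite e.
by rewrite /x' -!addrA -!opprD => ->.
Qed.

(** The norm is by definition the supremum of its finite partial sums. *)
Lemma truncation_approx (x : l1sum X) (d : R) : 0 < d ->
  exists2 s : seq I, uniq s & `|x| - d < \sum_(i <- s) `|coord i x|.
Proof.
move=> d0.
have xfin : l1norm x \is a fin_num by rewrite -l1sumE.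
have [_ [/= A [finA _] <-]] := ub_ereal_sup_adherent d0 xfin.
rewrite [ereal_sup _](_ : _ = (`|x|)%:E); last by rewrite l1sumE.
rewrite fsbig_finite// sumEFin lte_fin => h.
by exists (finmap.enum_fset (fset_set A)) => //; exact: finmap.fset_uniq.
Qed.

(* If every restriction of f had norm at most c, then so would f, by
   approximating each x by its finite truncations. *)
Lemma ball_sup_coord (f : {linear l1sum X -> R^o}) (a : R) :
  continuous f -> 0 < a -> nonzero (l1sum X) ->
  exists i, nonzero (X i) /\ ball_sup f - a < ball_sup (f \o @coord_inj i).
Proof.
move=> cf a0 /nonzero_coord[i0 nz0]; apply: contrapT => /forallNP small.
have cfi i : continuous (f \o @coord_inj i).
  by move=> u; apply: continuous_comp; [exact: coord_inj_continuous|exact: cf].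
pose c := ball_sup f - a.
have le_c i : nonzero (X i) -> ball_sup (f \o @coord_inj i) <= c.
  by move=> nz; rewrite leNgt; apply/negP => h; exact: (small i).
(* A nonzero summand forces [c >= 0], which serves to bound [c] times a partial sum of norms by
   [c]. *)
have c0 : 0 <= c by apply: le_trans (le_c i0 nz0); apply: ball_sup_ge0; exact: cfi.
have fi i (u : X i) : f (coord_inj u) <= c * `|u|.
  have [->|u0] := eqVneq u 0; first by rewrite !linear0 normr0 mulr0.
  apply: le_trans (le_ball_sup_norm (cfi i) u) _.
  by rewrite ler_wpM2r// le_c//; exists u.
suff : ball_sup f <= c by rewrite /c; lra.
apply: ge_sup; first exact: (ball_image_has_sup cf).1.
move=> _ [x /= x1 <-]; apply/ler_addgt0Pr => e e0.
have B0 := ball_sup_ge0 cf.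
(* The added 1 keeps the denominator positive; the tail then contributes at most [e]. *)
have d0 : 0 < e / (ball_sup f + 1) by rewrite divr_gt0// ltr_wpDl.
have [s us xs] := truncation_approx x d0.
rewrite -[x in f x](subrK (\sum_(i <- s) coord_inj (coord i x))) linearD /=.
rewrite addrC lerD//.
  rewrite linear_sum /=.
  apply: (@le_trans _ _ (\sum_(i <- s) c * `|coord i x|)).
    by apply: ler_sum => i _; exact: fi.
  rewrite -mulr_sumr ler_piMr//.
  have := normr_ge0 (x - \sum_(i <- s) coord_inj (coord i x)).
  rewrite norm_sub_truncation// subr_ge0 => /le_trans; exact.
apply: le_trans (le_ball_sup_norm cf _) _; rewrite norm_sub_truncation//.
apply: (@le_trans _ _ (ball_sup f * (e / (ball_sup f + 1)))).
  by rewrite ler_wpM2l//; lra.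
by rewrite mulrA ler_pdivrMr ?ltr_wpDl// mulrC ler_pM2l//; lra.
Qed.

End l1sum_coordinates.

(** * Normalized coordinates, norm comparisons and transfer of slices *)

Section coordinatewise.
Context {R : realType} {I : choiceType} (X : I -> completeNormedModType R).

(** The vector [e] is a default for a vanishing coordinate, so that a unit [e] always yields a unit
    vector. *)
Definition direction i (e : X i) (y : l1sum X) : X i :=
  if coord i y == 0 then e else `|coord i y|^-1 *: coord i y.

Lemma direction_norm i (e : X i) (y : l1sum X) :
  `|e| = 1 -> `|direction e y| = 1.
Proof.
rewrite /direction; case: eqVneq => // y0 _.
by rewrite normrZ normfV normr_id mulVf// normr_eq0.
Qed.

(** Normalizing a nonzero coordinate moves it by [1 - |coord i y|], exactly the norm that [y]
    carries elsewhere. If the coordinate is zero, the right-hand side equals [1 + |u|]. *)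
Lemma norm_add_direction_le i (e u : X i) (y : l1sum X) :
  `|e| = 1 -> `|y| = 1 -> `|direction e y + u| <= `|y + coord_inj u|.
Proof.
move=> e1 y1; rewrite norm_add_coord_inj y1 /direction.
case: eqVneq => [->|y0].
  by rewrite normr0 add0r subr0 -e1 addrC ler_normD.
have ny : 0 < `|coord i y| by rewrite normr_gt0.
have yle : `|coord i y| <= 1 by rewrite -y1 norm_coord_le.
have -> : `|coord i y|^-1 *: coord i y + u =
    (coord i y + u) + (`|coord i y|^-1 - 1) *: coord i y.
  by rewrite scalerBl scale1r [RHS]addrC addrA subrK.
apply: le_trans (ler_normD _ _) _; rewrite lerD2l normrZ.
rewrite ger0_norm ?subr_ge0 ?invf_ge1// mulrBl mulVf ?gt_eqF// mul1r.
exact: lexx.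
Qed.

(** With [t] the norm of [coord i x] and [v] its direction, [coord i x + u] is
    [t (u + v) + (1 - t) u], and the other coordinates add at most [1 - t]. *)
Lemma norm_add_coord_le i (u : X i) (x : l1sum X) : `|u| = 1 -> `|x| <= 1 ->
  coord i x != 0 ->
  `|coord i x| * (2 - `|u + `|coord i x|^-1 *: coord i x|) <=
  2 - `|coord_inj u + x|.
Proof.
move=> u1 x1 xi0; rewrite [coord_inj u + x]addrC norm_add_coord_inj.
set t := `|coord i x|; set v := t^-1 *: _.
have t0 : 0 < t by rewrite normr_gt0.
have t1 : t <= 1 by apply: le_trans (norm_coord_le i x) x1.
have -> : coord i x + u = t *: (u + v) + (1 - t) *: u.
  rewrite scalerDr scalerA divff ?gt_eqF// scale1r scalerBl scale1r.
  by rewrite [RHS]addrC addrA subrK addrC.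
have := ler_normD (t *: (u + v)) ((1 - t) *: u).
by rewrite !normrZ u1 mulr1 gtr0_norm// [`|1 - t|]ger0_norm ?subr_ge0//; nra.
Qed.

Lemma slice_coord (S : set (l1sum X)) : nonzero (l1sum X) -> is_slice S ->
  exists i (S' : set (X i)), [/\ nonzero (X i), is_slice S' &
    forall u, S' u -> S (coord_inj u)].
Proof.
move=> nz [f [a [cf a0 ->]]].
(* Half of [a] pays for restricting [f] to a summand, half is the width of the new slice. *)
have a20 : 0 < a / 2 by rewrite divr_gt0.
have [i [nzi fi]] := ball_sup_coord cf a20 nz.
exists i, (slice (f \o @coord_inj _ _ X i) (a / 2)); split=> //.
  apply: slice_is_slice => // u.
  by apply: continuous_comp; [exact: coord_inj_continuous|exact: cf].
move=> u [u1 fu]; split; first by rewrite /unit_ball /= norm_coord_inj.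
rewrite -/(ball_sup f); move: fi fu => /=; lra.
Qed.

Lemma slice_coord_inj i (S : set (X i)) : nonzero (X i) -> is_slice S ->
  exists2 S' : set (l1sum X), is_slice S' & forall x, S' x ->
    [/\ `|x| <= 1, 1 / 2 < `|coord i x| & S (`|coord i x|^-1 *: coord i x)].
Proof.
move=> nz sS; have [f [a [cf a0 f0 fS]]] := ball_sup_gt0_slice nz sS.
pose g : {linear l1sum X -> R^o} := f \o @coord _ _ X i.
have cg : continuous g.
  by move=> u; apply: continuous_comp; [exact: coord_continuous|exact: cf].
have fg : ball_sup f <= ball_sup g.
  apply: ge_sup; first exact: (ball_image_has_sup cf).1.
  move=> _ [u /= u1 <-]; rewrite -[u]coord_injE.
  by apply: (le_ball_sup cg); rewrite norm_coord_inj.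
(* The bound [a] keeps the normalized coordinate in the given slice; half the norm of [f] forces
   [|coord i x| > 1/2]. *)
pose b := Num.min a (ball_sup f / 2).
have b0 : 0 < b by rewrite lt_min a0 divr_gt0.
exists (slice g b); first exact: slice_is_slice.
move=> x [x1 gx]; set t := `|coord i x|.
have fx : ball_sup f - b < f (coord i x).
  by apply: le_lt_trans gx; rewrite lerD2r.
have ba : b <= a by rewrite ge_min lexx.
have bf : b <= ball_sup f / 2 by rewrite ge_min lexx orbT.
have t2 : 1 / 2 < t.
  have := le_ball_sup_norm cf (coord i x); rewrite -/t => h.
  by rewrite -(ltr_pM2l f0); lra.
have t1 : t <= 1 by apply: le_trans (norm_coord_le i x) x1.
have t0 : 0 < t by lra.
split=> //; apply: fS; split.
  by rewrite /unit_ball /= normrZ normfV normr_id mulVf// gt_eqF.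
have -> : f (t^-1 *: coord i x) = t^-1 * f (coord i x) by rewrite linearZ.
(* Normalization does not decrease a positive value of [f], as [t <= 1]. *)
apply: (@lt_le_trans _ _ (f (coord i x))); first by lra.
by rewrite ler_peMl ?invf_ge1//; lra.
Qed.

Lemma card_image_le_trans (T U V : Type) (f : T -> U) (Y : set T) (K : set V) :
  Y #<= K -> f @` Y #<= K.
Proof. exact/card_le_trans/card_image_le. Qed.

(** * Passage of both properties between the sum and its summands *)

Section transfer.
Variable K : Type.

Lemma l1sum_Daugavet :
  (forall i, Daugavet K (X i)) -> Daugavet K (l1sum X).
Proof.
move=> D; have [nz|] := pselect (nonzero (l1sum X)); last first.
  by move=> /zero_perfect_Daugavet/perfect_Daugavet_Daugavet.
move=> Y Ysph YK S sS e e0.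
have [i [S' [[w w0] sS' S'S]]] := slice_coord nz sS.
(* A unit vector to stand in where the coordinate of some [y] vanishes. *)
pose w' := `|w|^-1 *: w.
have w'1 : `|w'| = 1 by rewrite normrZ normfV normr_id mulVf// normr_eq0.
have Y'sph : direction w' @` Y `<=` @unit_sphere R (X i).
  by move=> _ [y _ <-]; exact: direction_norm.
have [u S'u uY] := D i _ Y'sph (card_image_le_trans _ YK) _ sS' _ e0.
exists (coord_inj u); first exact: S'S.
move=> y Yy; apply: lt_le_trans (norm_add_direction_le _ w'1 (Ysph _ Yy)).
by apply: uY; exists y.
Qed.

Lemma l1sum_perfect_Daugavet :
  (forall i, perfect_Daugavet K (X i)) -> perfect_Daugavet K (l1sum X).
Proof.
move=> D; have [nz|] := pselect (nonzero (l1sum X)); last first.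
  exact: zero_perfect_Daugavet.
move=> Y Ysph YK S sS.
have [i [S' [[w w0] sS' S'S]]] := slice_coord nz sS.
pose w' := `|w|^-1 *: w.
have w'1 : `|w'| = 1 by rewrite normrZ normfV normr_id mulVf// normr_eq0.
have Y'sph : direction w' @` Y `<=` @unit_sphere R (X i).
  by move=> _ [y _ <-]; exact: direction_norm.
have [u S'u uY] := D i _ Y'sph (card_image_le_trans _ YK) _ sS'.
exists (coord_inj u); first exact: S'S.
(* The upper bound 2 is the triangle inequality; the lower one compares with [X i]. *)
move=> y Yy; apply/le_anti/andP; split.
  have u1 : `|u| <= 1 by have [f [a [_ _ S'E]]] := sS'; move: S'u; rewrite S'E => -[].
  apply: le_trans (ler_normD _ _) _; rewrite norm_coord_inj (Ysph _ Yy).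
  by rewrite -[2]/(1 + 1) lerD2l.
rewrite -(uY (direction w' y)); last by exists y.
exact: norm_add_direction_le w'1 (Ysph _ Yy).
Qed.

Lemma coord_Daugavet i : Daugavet K (l1sum X) -> Daugavet K (X i).
Proof.
move=> D; have [nz|] := pselect (nonzero (X i)); last first.
  by move=> /zero_perfect_Daugavet/perfect_Daugavet_Daugavet.
move=> Y Ysph YK S sS e e0.
have [S' sS' S'S] := slice_coord_inj nz sS.
have Y'sph : @coord_inj _ _ X i @` Y `<=` @unit_sphere R (l1sum X).
  by move=> _ [y Yy <-]; rewrite /unit_sphere /= norm_coord_inj; exact: Ysph.
(* Halving [e] offsets the final division by [|coord i x| > 1/2]. *)
have e20 : 0 < e / 2 by rewrite divr_gt0.
have [x S'x xY] := D _ Y'sph (card_image_le_trans _ YK) _ sS' _ e20.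
have [x1 x2 Sx] := S'S _ S'x; exists (`|coord i x|^-1 *: coord i x) => //.
move=> y Yy.
have xi0 : coord i x != 0 by rewrite -normr_gt0; lra.
have := norm_add_coord_le (Ysph _ Yy) x1 xi0.
have : 2 - e / 2 < `|coord_inj y + x| by apply: xY; exists y.
nra.
Qed.

Lemma coord_perfect_Daugavet i :
  perfect_Daugavet K (l1sum X) -> perfect_Daugavet K (X i).
Proof.
move=> D; have [nz|] := pselect (nonzero (X i)); last first.
  exact: zero_perfect_Daugavet.
move=> Y Ysph YK S sS.
have [S' sS' S'S] := slice_coord_inj nz sS.
have Y'sph : @coord_inj _ _ X i @` Y `<=` @unit_sphere R (l1sum X).
  by move=> _ [y Yy <-]; rewrite /unit_sphere /= norm_coord_inj; exact: Ysph.
have [x S'x xY] := D _ Y'sph (card_image_le_trans _ YK) _ sS'.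
have [x1 x2 Sx] := S'S _ S'x; exists (`|coord i x|^-1 *: coord i x) => //.
move=> y Yy.
have t0 : 0 < `|coord i x| by lra.
have xi0 : coord i x != 0 by rewrite -normr_gt0.
have := norm_add_coord_le (Ysph _ Yy) x1 xi0.
(* The defect from 2 vanishes in the sum, so the defect in [X i], times a positive number, is at
   most zero. *)
rewrite xY; last by exists y.
rewrite subrr pmulr_rle0// subr_le0 => h.
apply/le_anti/andP; split=> //.
apply: le_trans (ler_normD _ _) _; rewrite (Ysph _ Yy).
by rewrite normrZ normfV normr_id mulVf// gt_eqF.
Qed.

End transfer.

End coordinatewise.

(** * The equivalences and the resulting identities of cardinals *)

Theorem proposition6p1 (R : realType) (I : choiceType)
    (X : I -> completeNormedModType R) :
  (forall K : Type, Daugavet K (l1sum X) <-> forall i, Daugavet K (X i)) /\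
  (forall K : Type,
     perfect_Daugavet K (l1sum X) <-> forall i, perfect_Daugavet K (X i)) /\
  (nonzero (l1sum X) ->
     (exists K : Type, is_Dau (l1sum X) K /\
        is_min_cardinal [set i | nonzero (X i)] (fun i => is_Dau (X i)) K) /\
     (exists K : Type, is_pDau (l1sum X) K /\
        is_min_cardinal [set i | nonzero (X i)] (fun i => is_pDau (X i)) K)).
Proof.
have D K : Daugavet K (l1sum X) <-> forall i, Daugavet K (X i).
  by split=> [D i|]; [exact: coord_Daugavet|exact: l1sum_Daugavet].
have pD K : perfect_Daugavet K (l1sum X) <-> forall i, perfect_Daugavet K (X i).
  by split=> [pD i|]; [exact: coord_perfect_Daugavet|exact: l1sum_perfect_Daugavet].
split=> //; split=> // /nonzero_coord nz.
have nD i : [set i | nonzero (X i)] i -> exists K, ~ Daugavet K (X i).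
  by move=> nzi; exists (X i); exact: nonzero_not_Daugavet.
have npD i : [set i | nonzero (X i)] i -> exists K, ~ perfect_Daugavet K (X i).
  by move=> /nD[K nDK]; exists K => /perfect_Daugavet_Daugavet.
(* Zero summands have both properties, so failure in the sum is witnessed by a nonzero summand. An
   equality of propositions can be substituted inside [least_cardinal]. *)
have fails (Q : Prop) (P : I -> Prop) : (Q <-> forall i, P i) ->
    (forall i, ~ nonzero (X i) -> P i) ->
    (exists2 i, [set i | nonzero (X i)] i & ~ P i) = ~ Q.
  move=> QP zP; apply/propext; split=> [[i _ nPi] /QP//|nQ].
  apply: contrapT => /forall2NP h; apply/nQ/QP => i.
  by have [/zP//|/contrapT] := h i.
split.
  have [K [leK minK]] :=
    least_cardinal_bigcup nz (fun i => @not_Daugavet_upward R (X i)) nD.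
  exists K; split=> //; rewrite /is_Dau.
  congr (least_cardinal _ K): leK; apply/funext => L.
  by apply: fails => // i /zero_perfect_Daugavet/perfect_Daugavet_Daugavet.
have [K [leK minK]] :=
  least_cardinal_bigcup nz (fun i => @not_perfect_Daugavet_upward R (X i)) npD.
exists K; split=> //; rewrite /is_pDau.
congr (least_cardinal _ K): leK; apply/funext => L.
by apply: fails => // i; exact: zero_perfect_Daugavet.
Qed.
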